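(* Let $E$ be a finite set with $n=|E|$ elements and let $\nu\colon 2^{E}\to\mathbb{R}\cup\{-\infty\}$ be an $\mathrm{M}^\natural$-concave function. For $0\le k\le n$ and $0<q\le 1$ set $I_{q,\nu;k}=\sum_{I\subseteq E,\,|I|=k} q^{-\nu(I)}$. Then \[ I_{q,\nu;k}^2 \geq \Big(1+\frac1k\Big)\Big(1+\frac1{n-k}\Big) I_{q,\nu;k-1}I_{q,\nu;k+1}\quad\text{for all } 0<k<n \text{ and } 0<q\le 1. \]
   Context: A function $\nu\colon 2^E\to\mathbb{R}\cup\{-\infty\}$ is $\mathrm{M}^\natural$-concave if for any $I_1,I_2\subseteq E$ and $i_1\in I_1\setminus I_2$, either $\nu(I_1)+\nu(I_2)\le \nu(I_1\setminus i_1)+\nu(I_2\cup i_1)$, or there is $i_2\in I_2\setminus I_1$ with $\nu(I_1)+\nu(I_2)\le \nu((I_1\setminus i_1)\cup i_2)+\nu((I_2\setminus i_2)\cup i_1)$. Its effective domain $\{I:\nu(I)\ne-\infty\}$ is assumed nonempty. Convention: $q^{\infty}=0$, i.e. $q^{-\nu(I)}=0$ when $\nu(I)=-\infty$. *)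

(* Defs.v *)
From HB Require Import structures.
From mathcomp Require Import all_boot all_order all_algebra.
From mathcomp Require Import all_classical all_reals ereal exp.
Set Implicit Arguments. Unset Strict Implicit. Unset Printing Implicit Defensive.
Import Order.TTheory GRing.Theory Num.Theory.
Local Open Scope ring_scope.

Definition valued_in_R_minf (R : realType) (E : finType) (nu : {set E} -> \bar R) :=
  forall I, nu I != +oo%E.

(* M-natural concavity, as in the paper (sums in the extended reals,
   x + -oo = -oo for x <> +oo). *)
Definition Mnat_concave (R : realType) (E : finType) (nu : {set E} -> \bar R) :=
  [/\ valued_in_R_minf nu,
      (exists I, nu I != -oo%E) &
      forall (I1 I2 : {set E}) (i1 : E), i1 \in I1 :\: I2 ->
        (nu I1 + nu I2 <= nu (I1 :\ i1) + nu (i1 |: I2))%E \/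
        exists2 i2, i2 \in I2 :\: I1 &
          (nu I1 + nu I2 <= nu (i2 |: (I1 :\ i1)) + nu (i1 |: (I2 :\ i2)))%E].

(* q^{-nu(I)}, with the convention q^{-(-oo)} = q^{oo} = 0. *)
Definition qweight (R : realType) (q : R) (x : \bar R) : R :=
  match x with
  | EFin r => q `^ (- r)
  | _ => 0
  end.

Definition Iqnu (R : realType) (E : finType) (q : R) (nu : {set E} -> \bar R) (k : nat) : R :=
  \sum_(I : {set E} | #|I| == k) qweight q (nu I).

(* Main.v *)
(* The weights [w I = q^(-nu I)] satisfy a multiplicative exchange property.  With
   [n = |E|], the inequality for [k] is the instance [S = set0], [v = e_0] of a
   reversed Cauchy-Schwarz inequality for the Hessians, at the point [x_0 = 0],
   [x_i = 1], of the derivatives along the sets [S] of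
   [d_0^(n-k-1) sum_I w(I) x_0^(n-|I|) x^I], a polynomial of degree [k + 1].  The
   inequality is proved by downward induction on [|S|].
   When the derivative is quadratic, exchange says that, after rescaling, the
   coefficients form an ultrametric, and an ultrametric similarity matrix with unit
   diagonal on at most [m] points is bounded below by [J / m], [J] the all-ones
   matrix; this is where the factor [1 + 1/(n-k)] comes from.
   Otherwise Euler's identity expresses the Hessian [H] at [S] through those at
   [S + i], and the induction hypothesis becomes [H <= H D H] with [D] diagonal and
   [D H x = x] on [E].  The exchange property makes the eigenvectors of [D H] for
   the eigenvalue 1 multiples of [x], and then [H <= 0] on the hyperplane
   orthogonal to [H x]. *)
Require Import Defs.
From mathcomp Require Import all_classical all_reals ereal exp.
From mathcomp Require Import all_boot all_order all_algebra.
From mathcomp Require Import ring lra zify.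
Set Implicit Arguments. Unset Strict Implicit. Unset Printing Implicit Defensive.
Import Order.TTheory GRing.Theory Num.Theory.
Local Open Scope ring_scope.

(** * Symmetric bilinear forms on a finite index set *)

Definition dot (R : realFieldType) (T : finType) (u v : T -> R) : R :=
  \sum_i u i * v i.

Definition ap (R : realFieldType) (T : finType) (H : T -> T -> R) (v : T -> R) : T -> R :=
  fun i => \sum_j H i j * v j.

Lemma sum_option (R : realFieldType) (E : finType) (F : option E -> R) :
  \sum_o F o = F None + \sum_i F (Some i).
Proof.
rewrite (bigD1 None) //=; congr (_ + _).
rewrite (reindex_omap Some id) /=; last by case.
by apply: eq_bigl => i; rewrite eqxx.
Qed.

Lemma dotC (R : realFieldType) (T : finType) (u v : T -> R) : dot u v = dot v u.
Proof. by apply: eq_bigr => i _; rewrite mulrC. Qed.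

Lemma dotDZr (R : realFieldType) (T : finType) (a : R) (u v w : T -> R) :
  dot u (fun i => v i + a * w i) = dot u v + a * dot u w.
Proof.
rewrite /dot mulr_sumr -big_split /=; apply: eq_bigr => i _; ring.
Qed.

Lemma eq_dot (R : realFieldType) (T : finType) (u v u' v' : T -> R) :
  u =1 u' -> v =1 v' -> dot u v = dot u' v'.
Proof. by move=> eu ev; apply: eq_bigr => i _; rewrite eu ev. Qed.

Lemma apDZ (R : realFieldType) (T : finType) (H : T -> T -> R) (a : R) (v w : T -> R) i :
  ap H (fun j => v j + a * w j) i = ap H v i + a * ap H w i.
Proof. exact: (dotDZr a (H i) v w). Qed.

Lemma dot_apC (R : realFieldType) (T : finType) (H : T -> T -> R) (u v : T -> R) :
  (forall i j, H i j = H j i) -> dot u (ap H v) = dot v (ap H u).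
Proof.
move=> Hsym; rewrite /dot /ap.
under eq_bigr do rewrite mulr_sumr.
under [RHS]eq_bigr do rewrite mulr_sumr.
rewrite exchange_big /=; apply: eq_bigr => i _; apply: eq_bigr => j _.
rewrite Hsym; ring.
Qed.

Lemma dot_apDZ (R : realFieldType) (T : finType) (H : T -> T -> R) (a : R) (u v : T -> R) :
  (forall i j, H i j = H j i) ->
  dot (fun i => u i + a * v i) (ap H (fun i => u i + a * v i)) =
  dot u (ap H u) + a * dot v (ap H u) *+ 2 + a ^+ 2 * dot v (ap H v).
Proof.
move=> Hsym; rewrite (eq_dot (fun=> erefl) (apDZ H a u v)) dotDZr.
rewrite (dotC _ (ap H u)) (dotC _ (ap H v)) !dotDZr.
rewrite (dotC (ap H u) u) (dotC (ap H u) v) (dotC (ap H v) u) (dotC (ap H v) v).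
rewrite (dot_apC u v) //; ring.
Qed.

(** The row space of a matrix is the annihilator of its kernel: the columns of [cokermx M] lie in
    the kernel of [M], so [u] kills them. With [A = 1 - H D] and [H] symmetric, this solves
    [v = (1 - D H) f]. *)
Lemma row_span_annihilator (R : realFieldType) (T : finType) (A : T -> T -> R) (u : T -> R) :
  (forall z, (forall i, ap A z i = 0) -> dot u z = 0) ->
  exists f, forall j, u j = \sum_i f i * A i j.
Proof.
move=> Au.
pose M := \matrix_(i < #|T|, j < #|T|) A (enum_val i) (enum_val j).
pose U := \row_(j < #|T|) u (enum_val j).
have reT (F : T -> R) : \sum_(i < #|T|) F (enum_val i) = \sum_i F i.
  by rewrite [RHS](reindex (@enum_val T T)) //; apply: onW_bij; exact: enum_val_bij.
have /submxP [f Uf] : (U <= M)%MS.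
  rewrite submxE; apply/eqP/rowP => k; rewrite mxE [RHS]mxE.
  move: (cokermx M) (mulmx_coker M) => C MC.
  pose z i := C (enum_rank i) k.
  suff Az : forall i, ap A z i = 0.
    rewrite -[RHS](Au z Az) -[RHS]reT; apply: eq_bigr => j _.
    by rewrite !mxE /z enum_valK.  move=> i.
  have /matrixP/(_ (enum_rank i) k) := MC.
  rewrite mxE [RHS]mxE => <-; rewrite /ap -reT; apply: eq_bigr => j _.
  by rewrite !mxE /z enum_valK enum_rankK.
exists (fun i => f 0 (enum_rank i)) => j.
have := congr1 (fun V : 'rV_#|T| => V 0 (enum_rank j)) Uf.
rewrite /U !mxE enum_rankK => ->.
rewrite -[RHS]reT; apply: eq_bigr => i _.
by rewrite !mxE enum_rankK enum_valK.
Qed.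

(* Every [v] orthogonal to [b] has the form [(1 - D H) f], and then
   [v^T H v = (f^T H f - f^T H D H f) + (f^T H D H D H f - f^T H D H f)]. *)
Lemma hyperplane_nonpositive (R : realFieldType) (T : finType)
    (H : T -> T -> R) (D b : T -> R) :
  (forall i j, H i j = H j i) ->
  (forall f, dot f (ap H f) <= \sum_i D i * ap H f i ^+ 2) ->
  (forall g, dot (fun i => D i * g i) (ap H (fun i => D i * g i))
     <= \sum_i D i * g i ^+ 2) ->
  (forall y, (forall i, y i = D i * ap H y i) -> exists c, forall i, ap H y i = c * b i) ->
  forall v, dot v b = 0 -> dot v (ap H v) <= 0.
Proof.
move=> Hsym leHDH leDHD harm v vb.
have [z Hz|f vf] := @row_span_annihilator R T (fun i j => (i == j)%:R - H i j * D j) v.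
  (* The kernel condition says [z = H D z]. Then [D z] is fixed by [D H], so [harm] makes [z] a
     multiple of [b], hence orthogonal to [v]. *)
  have zE i : z i = ap H (fun j => D j * z j) i.
    apply/eqP; rewrite -subr_eq0 -(Hz i) /ap -{1}[z i]mul1r; apply/eqP.
    under [RHS]eq_bigr do rewrite mulrBl.
    rewrite sumrB; congr (_ - _); last by apply: eq_bigr => j _; ring.
    rewrite (bigD1 i) //= eqxx big1 ?addr0 // => j ji.
    by rewrite eq_sym (negPf ji) mul0r.
  have [i|c Hc] := harm (fun j => D j * z j); first by rewrite -zE.
  rewrite (eq_dot (fun=> erefl) (v' := fun i => 0 + c * b i)); last first.
    by move=> i; rewrite zE Hc add0r.
  rewrite dotDZr vb mulr0 addr0.
  by rewrite /dot big1 // => i _; rewrite mulr0.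
pose e i := D i * ap H f i.
have ve i : v i = f i + (-1) * e i.
  rewrite vf; under eq_bigr do rewrite mulrBr.
  rewrite sumrB mulN1r; congr (_ - _).
    rewrite (bigD1 i) //= eqxx mulr1 big1 ?addr0 // => j /negPf ->.
    by rewrite mulr0.
  rewrite /e /ap mulr_sumr; apply: eq_bigr => j _; rewrite (Hsym j i); ring.
have eHv : ap H v =1 ap H (fun i => f i + (-1) * e i).
  by move=> i; apply: eq_bigr => j _; rewrite ve.
rewrite (eq_dot ve eHv) dot_apDZ //.
have eE : dot e (ap H f) = \sum_i D i * ap H f i ^+ 2.
  by apply: eq_bigr => i _; rewrite /e; ring.
have := leHDH f; have := leDHD (ap H f); rewrite -/e eE; lra.
Qed.

(** Some [v + s x] lies on the hyperplane, where the form [G + 2 s B + s^2 F] is nonpositive.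
    Multiplied by [F > 0] it equals [F G - B^2 + (B + s F)^2], which leaves [F G <= B^2]. *)
Lemma reversed_cauchy_schwarz (R : realFieldType) (T : finType)
    (H : T -> T -> R) (b x : T -> R) :
  (forall i j, H i j = H j i) ->
  (forall u, dot u b = 0 -> dot u (ap H u) <= 0) ->
  0 < dot x (ap H x) ->
  forall v, dot v (ap H v) * dot x (ap H x) <= dot x (ap H v) ^+ 2.
Proof.
move=> Hsym neg x0 v.
have xb : dot x b != 0 by apply/eqP => /neg; rewrite leNgt x0.
pose s := - dot v b / dot x b.
have := neg (fun i => v i + s * x i).
rewrite dot_apDZ // (dotC _ b) dotDZr (dotC b v) (dotC b x) => ineq.
have {ineq} : dot v (ap H v) + s * dot x (ap H v) *+ 2 + s ^+ 2 * dot x (ap H x) <= 0.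
  by apply: ineq; rewrite /s; field.
move: x0; set F := dot x (ap H x); set G := dot v _; set B := dot x _ => F0 le0.
have : F * (G + s * B *+ 2 + s ^+ 2 * F) <= 0 by rewrite pmulr_rle0.
have := sqr_ge0 (B + s * F); lra.
Qed.

(** * Dirichlet forms and harmonic vectors *)

(** Summation by parts, swapping [i] and [j] in one of two copies of the sum. It serves twice: for
    the sign of a form, and to show that harmonic vectors are constant along edges of positive
    weight. *)
Lemma dirichlet_form (R : realFieldType) (T : finType) (H : T -> T -> R) (y : T -> R) :
  (forall i j, H i j = H j i) ->
  \sum_i \sum_j H i j * (y i - y j) ^+ 2 =
  (\sum_i y i * \sum_j H i j * (y i - y j)) *+ 2.
Proof.
move=> Hsym; rewrite mulr2n.
set S := \sum_i y i * _.
have S1 : S = \sum_i \sum_j H i j * (y i - y j) * y i.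
  by apply: eq_bigr => i _; rewrite mulr_sumr; apply: eq_bigr => j _; rewrite mulrC.
have S2 : S = \sum_i \sum_j H i j * (y j - y i) * y j.
  rewrite S1 exchange_big; apply: eq_bigr => i _; apply: eq_bigr => j _ /=.
  by rewrite Hsym.
rewrite {1}S1 S2 -big_split; apply: eq_bigr => i _ /=.
by rewrite -big_split; apply: eq_bigr => j _ /=; ring.
Qed.

(* [H] is the Hessian of a polynomial at the point [x] with [x None = 0] and
   [x (Some i) = 1], and [b = H x]. *)
Lemma local_to_global (R : realFieldType) (E : finType)
    (H : option E -> option E -> R) (b : option E -> R) :
  (forall i j, H i j = H j i) ->
  (forall i j, 0 <= H i j) ->
  (forall i, b i = \sum_j H i (Some j)) ->
  (forall v, dot v (ap H v) <= \sum_i (b (Some i))^-1 * ap H v (Some i) ^+ 2) ->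
  (forall i j, 0 < b (Some i) -> 0 < b (Some j) ->
     exists k, (i = k \/ 0 < H (Some i) (Some k)) /\
               (k = j \/ 0 < H (Some k) (Some j))) ->
  (forall j, 0 < H None (Some j) -> 0 < b (Some j)) ->
  forall v, dot v b = 0 -> dot v (ap H v) <= 0.
Proof.
move=> Hsym H0 bE leHDH conn supp.
have b0 i : 0 <= b i by rewrite bE sumr_ge0.
have Hb i j : 0 < H i (Some j) -> 0 < b (Some j).
  case: i => [i|]; last exact: supp.
  move=> ij; rewrite bE (bigD1 i) //= Hsym ltr_pwDl // ?(Hsym (Some j)) //.
  by rewrite sumr_ge0.
pose h i j := H (Some i) (Some j).
have hsym i j : h i j = h j i by exact: Hsym.
apply: (@hyperplane_nonpositive R _ H (fun o => if o is Some i then (b (Some i))^-1 else 0)).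
- by [].
- by move=> f; rewrite sum_option mul0r add0r.
- move=> g; rewrite sum_option mul0r add0r.
  rewrite /dot sum_option !mul0r add0r.
  pose e i := (b (Some i))^-1 * g (Some i).
  under eq_bigr do rewrite /ap sum_option mul0r mulr0 add0r -/(e _).
  have -> : \sum_i (b (Some i))^-1 * g (Some i) ^+ 2 = \sum_i b (Some i) * e i ^+ 2.
    apply: eq_bigr => i _; rewrite /e.
    have [->|bi] := eqVneq (b (Some i)) 0; first by rewrite invr0 !mul0r.
    by field.
  rewrite -subr_ge0 -sumrB.
  (* As [b (Some i)] is the sum of row [i] of [h], the difference of the two sides is half a
     Dirichlet form with nonnegative weights. *)
  have <- : \sum_i e i * \sum_j h i j * (e i - e j) =
    \sum_i (b (Some i) * e i ^+ 2
      - e i * \sum_j H (Some i) (Some j) * ((b (Some j))^-1 * g (Some j))).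
    apply: eq_bigr => i _; rewrite bE /h -/(e _).
    under eq_bigr do rewrite mulrBr.
    by rewrite sumrB -mulr_suml; rewrite /e; ring.
  rewrite -(@pmulrn_lge0 _ _ 2) // -dirichlet_form //.
  by apply: sumr_ge0 => i _; apply: sumr_ge0 => j _; rewrite mulr_ge0 ?sqr_ge0 ?H0.
move=> y yE.
have y0 : y None = 0 by rewrite yE mul0r.
have harm i : \sum_j h i j * (y (Some i) - y (Some j)) = 0.
  under eq_bigr do rewrite mulrBr.
  rewrite sumrB -mulr_suml -bE.
  have -> : \sum_j h i j * y (Some j) = ap H y (Some i).
    by rewrite /ap sum_option y0 mulr0 add0r.
  (* Where [b] vanishes, [D] is [0^-1 = 0] and cannot be cancelled, but the row of [h] is then zero,
     being nonnegative with sum 0. *)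
  have [bi0|bi] := eqVneq (b (Some i)) 0; last first.
    by rewrite {1}(yE (Some i)) mulrA divff // mul1r subrr.
  rewrite bi0 mul0r sub0r /ap sum_option y0 mulr0 add0r big1 ?oppr0 // => j _.
  have /psumr_eq0P -> // : \sum_k H (Some i) (Some k) = 0 by rewrite -bE.
  by rewrite mul0r.
have eqh i j : 0 < h i j -> y (Some i) = y (Some j).
  move=> hij; have := dirichlet_form (fun k => y (Some k)) hsym.
  rewrite [X in _ = X *+ 2]big1 => [|k _]; last by rewrite harm mulr0.
  rewrite mul0rn => /psumr_eq0P => /(_ _ i isT) /psumr_eq0P => /(_ _ _ j isT).
  move=> /(_ _ _)/eqP; rewrite mulf_eq0 (gt_eqF hij) /= sqrf_eq0 subr_eq0 => yy.
  apply/eqP; apply: yy => k _; rewrite ?sumr_ge0 // => *;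
    by rewrite mulr_ge0 ?sqr_ge0 ?H0.
have eqy i j : 0 < b (Some i) -> 0 < b (Some j) -> y (Some i) = y (Some j).
  move=> bi bj; have [k [ik kj]] := conn i j bi bj.
  by case: ik => [->|/eqh ->]; case: kj => [->|/eqh ->].
(* [y] is constant on the support of [b], and by [Hb] every nonzero column [Some j] of [H] has its
   index there, so this constant is the required factor. *)
have [i0 bi0|nb] := pickP (fun i => 0 < b (Some i)).
  exists (y (Some i0)) => i; rewrite bE mulr_sumr /ap sum_option y0 mulr0 add0r.
  apply: eq_bigr => j _.
  have [->|Hij] := eqVneq (H i (Some j)) 0; first by rewrite mul0r mulr0.
  have {Hij} Hij : 0 < H i (Some j) by rewrite lt_def Hij H0.
  by rewrite (eqy j i0 (Hb i j Hij) bi0) mulrC.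
exists 0 => i; rewrite mul0r /ap sum_option y0 mulr0 add0r big1 // => j _.
have [->|Hij] := eqVneq (H i (Some j)) 0; first by rewrite mul0r.
have {Hij} Hij : 0 < H i (Some j) by rewrite lt_def Hij H0.
by have := nb j; rewrite (Hb i j).
Qed.

(** * Ultrametric matrices and quadratic forms with exchange *)

Lemma sum_sqr_le (R : realFieldType) (T : finType) (A : {set T}) (X : T -> R) :
  (\sum_(i in A) X i) ^+ 2 <= #|A|%:R * \sum_(i in A) X i ^+ 2.
Proof.
rewrite -subr_ge0 -(@pmulrn_lge0 _ _ 2) //.
have -> : (#|A|%:R * (\sum_(i in A) X i ^+ 2) - (\sum_(i in A) X i) ^+ 2) *+ 2 =
          \sum_(i in A) \sum_(j in A) (X i - X j) ^+ 2.
  have eC : #|A|%:R * (\sum_(i in A) X i ^+ 2) = \sum_(i in A) \sum_(j in A) X i ^+ 2.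
    by rewrite mulr_sumr; apply: eq_bigr => i _; rewrite sumr_const mulr_natl.
  have eC' : #|A|%:R * (\sum_(i in A) X i ^+ 2) = \sum_(i in A) \sum_(j in A) X j ^+ 2.
    by rewrite eC exchange_big.
  have eS : (\sum_(i in A) X i) ^+ 2 = \sum_(i in A) \sum_(j in A) X i * X j.
    by rewrite expr2 mulr_suml; apply: eq_bigr => i _; rewrite mulr_sumr.
  rewrite mulr2n {1}eC eC' eS -!sumrB -big_split; apply: eq_bigr => i _ /=.
  by rewrite -!sumrB -big_split; apply: eq_bigr => j _ /=; ring.
by apply: sumr_ge0 => i _; apply: sumr_ge0 => j _; exact: sqr_ge0.
Qed.

(** The form is the sum over the equivalence classes of the squared class sums. Each class is
    indexed by a representative in [A], so Cauchy-Schwarz over at most [#|A|] classes gives the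
    bound. *)
Lemma equivalence_form (R : realFieldType) (T : finType) (A : {set T}) (e : rel T)
    (t : T -> R) :
  {in A, reflexive e} -> {in A &, symmetric e} -> {in A & &, transitive e} ->
  (\sum_(i in A) t i) ^+ 2 <=
    #|A|%:R * \sum_(i in A) \sum_(j in A) (e i j)%:R * (t i * t j).
Proof.
move=> er es et.
pose r i := odflt i [pick j in A | e i j].
have rA i : i \in A -> r i \in A.
  by rewrite /r; case: pickP => //= j /andP[].
have er' i : i \in A -> e i (r i).
  by rewrite /r; case: pickP => /= [j /andP[]//|_]; exact: er.
have rE i j : i \in A -> j \in A -> e i j = (r i == r j).
  move=> iA jA; apply/idP/eqP => [eij|rij].
    rewrite /r; have -> : [pick k in A | e i k] = [pick k in A | e j k].
      apply: eq_pick => k /=; case: (boolP (k \in A)) => //= kA.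
      apply/idP/idP => [eik|ejk]; last exact: (et j).
      by apply: (et i) => //; rewrite es.
    by case: pickP => //= /(_ j); rewrite jA er.
  apply: (et (r i)) => //; rewrite ?rA ?er' //.
  by rewrite es ?rA // rij er'.
have -> : \sum_(i in A) t i = \sum_(k in A) \sum_(i in A | r i == k) t i.
  by rewrite (partition_big r (mem A)).
have -> : \sum_(i in A) \sum_(j in A) (e i j)%:R * (t i * t j) =
          \sum_(k in A) (\sum_(i in A | r i == k) t i) ^+ 2.
  rewrite (partition_big r (mem A)) //=; apply: eq_bigr => k kA.
  rewrite expr2 mulr_suml; apply: eq_bigr => i /andP[iA /eqP rik].
  rewrite mulr_sumr [RHS]big_mkcondr; apply: eq_bigr => j jA /=.
  rewrite rE // rik eq_sym; case: ifP; by rewrite ?mul1r ?mul0r.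
exact: sum_sqr_le.
Qed.

(* Subtracting the least positive value of [s] on its support keeps all the
   hypotheses, and the support is an equivalence relation: an ultrametric
   similarity is a nonnegative combination of equivalence relations. *)
Lemma ultrametric_form (R : realFieldType) (T : finType) (A : {set T})
    (s : T -> T -> R) (d : R) (t : T -> R) :
  0 <= d ->
  (forall i j, i \in A -> j \in A -> 0 <= s i j <= d) ->
  (forall i, i \in A -> s i i = d) ->
  (forall i j, i \in A -> j \in A -> s i j = s j i) ->
  (forall i j k, i \in A -> j \in A -> k \in A -> Num.min (s i k) (s k j) <= s i j) ->
  d * (\sum_(i in A) t i) ^+ 2 <=
    #|A|%:R * \sum_(i in A) \sum_(j in A) s i j * (t i * t j).
Proof.
have [N] := ubnP #|[set p | [&& p.1 \in A, p.2 \in A & 0 < s p.1 p.2]]|.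
elim: N => // N IHN in s d *; rewrite ltnS => cardN d0 s0d sd ssym sult.
have s0 i j : i \in A -> j \in A -> 0 <= s i j by move=> iA jA; case/andP: (s0d i j iA jA).
have sled i j : i \in A -> j \in A -> s i j <= d by move=> iA jA; case/andP: (s0d i j iA jA).
pose P := [set p | [&& p.1 \in A, p.2 \in A & 0 < s p.1 p.2]].
have PE i j : ((i, j) \in P) = [&& i \in A, j \in A & 0 < s i j] by rewrite inE.
have [p0 p0P|P0] := pickP (mem P); last first.
  have sz i j : i \in A -> j \in A -> s i j = 0.
    move=> iA jA; apply/eqP; rewrite eq_le s0 // andbT leNgt.
    by have := PE i j; rewrite iA jA (P0 (i, j) : (_ \in P) = _) /= => <-.
  rewrite [X in _ <= _ * X]big1 ?mulr0 => [|i iA]; last first.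
    by rewrite big1 // => j jA; rewrite sz // mul0r.
  have [->|[i iA]] := set_0Vmem A; first by rewrite big_set0 expr0n mulr0.
  by rewrite -(sd i iA) sz // mul0r.
have := @arg_minP _ R _ p0 (mem P) (fun p => s p.1 p.2) p0P.
case=> -[q1 q2] /= qP qmin.
have : (q1, q2) \in P := qP; rewrite PE => /and3P[q1A q2A qpos].
pose m := s q1 q2; pose e : rel T := fun i j => 0 < s i j.
have mle i j : i \in A -> j \in A -> e i j -> m <= s i j.
  by move=> iA jA eij; apply: (qmin (i, j) (_ : (i, j) \in P)); rewrite PE iA jA.
have md : m <= d by exact: sled.
have dpos : 0 < d by exact: lt_le_trans md.
pose s' i j := s i j - m * (e i j)%:R.
have s'0 i j : i \in A -> j \in A -> 0 <= s' i j.
  move=> iA jA; rewrite /s'; case: (boolP (e i j)) => [eij|_].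
    by rewrite mulr1 subr_ge0 mle.
  by rewrite mulr0 subr0 s0.
have e0 i j : i \in A -> j \in A -> ~~ e i j -> s i j = 0.
  by move=> iA jA; rewrite /e -leNgt => le0; apply/eqP; rewrite eq_le le0 s0.
have s'e i j : i \in A -> j \in A -> ~~ e i j -> s' i j = 0.
  by move=> iA jA neij; rewrite /s' (negPf neij) e0 // mulr0 subr0.
have er : {in A, reflexive e} by move=> i iA; rewrite /e sd.
have es : {in A &, symmetric e} by move=> i j iA jA; rewrite /e ssym.
have et : {in A & &, transitive e}.
  move=> k i j kA iA jA eik ekj; apply: lt_le_trans (sult i j k iA jA kA).
  by rewrite lt_min; apply/andP.
have E1 := equivalence_form t er es et.
have E2 : (d - m) * (\sum_(i in A) t i) ^+ 2 <=
    #|A|%:R * \sum_(i in A) \sum_(j in A) s' i j * (t i * t j).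
  apply: IHN.
  - apply: leq_trans cardN; rewrite -/P.
    apply: proper_card; apply/properP; split.
      apply/subsetP => -[i j]; rewrite PE inE /= => /and3P[-> -> /=].
      apply: contraTT => neij; rewrite /s' (_ : e i j = false) ?mulr0 ?subr0 //.
      exact: negPf.
    exists (q1, q2); first by rewrite -/P PE q1A q2A.
    rewrite inE /= q1A q2A /= /s' /e -/m qpos mulr1 subrr.
    by rewrite ltxx.
  - by rewrite subr_ge0.
  - move=> i j iA jA; rewrite s'0 //= /s'; case: (boolP (e i j)) => [_|eij].
      by rewrite mulr1 lerB ?sled.
    by rewrite e0 // mulr0 subr0 subr_ge0.
  - by move=> i iA; rewrite /s' sd // /e sd // dpos mulr1.
  - by move=> i j iA jA; rewrite /s' ssym // es.
  (* If [(i, k)] or [(k, j)] is outside [e], the minimum is at most 0. Otherwise transitivity puts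
     [(i, j)] in [e], and all three entries drop by the same [m]. *)
  - move=> i j k iA jA kA; have := sult i j k iA jA kA.
    rewrite !ge_min; case: (boolP (e i k)) => [eik|neik]; last first.
      by rewrite [s' i k]s'e // s'0.
    case: (boolP (e k j)) => [ekj|nekj]; last first.
      by rewrite [s' k j]s'e // s'0 // orbT.
    by rewrite /s' eik ekj (et k) // !lerBlDr !subrK.
have -> : \sum_(i in A) \sum_(j in A) s i j * (t i * t j) =
   m * (\sum_(i in A) \sum_(j in A) (e i j)%:R * (t i * t j)) +
   \sum_(i in A) \sum_(j in A) s' i j * (t i * t j).
  rewrite mulr_sumr -big_split; apply: eq_bigr => i _ /=.
  rewrite mulr_sumr -big_split; apply: eq_bigr => j _ /=.
  by rewrite /s'; ring.
have m0 : 0 <= m by exact: s0.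
rewrite mulrDr mulrCA; have := ler_wpM2l m0 E1; lra.
Qed.

(* The Farris transform: the exchange property makes [w i j / (l i * l j)] an
   ultrametric. *)
Lemma exchange_form (R : realFieldType) (T : finType) (A : {set T})
    (l : T -> R) (w : T -> T -> R) (M : R) (v : T -> R) :
  0 <= M ->
  (forall i, i \in A -> 0 < l i) ->
  (forall i j, 0 <= w i j) -> (forall i j, w i j = w j i) -> (forall i, w i i = 0) ->
  (forall i j k, w i j * l k <= l j * w i k \/ w i j * l k <= l i * w j k) ->
  (forall i j, i \in A -> j \in A -> w i j <= M * (l i * l j)) ->
  M * (\sum_(i in A) l i * v i) ^+ 2 <=
    #|A|%:R * (M * (\sum_(i in A) l i * v i) ^+ 2
               - \sum_(i in A) \sum_(j in A) w i j * (v i * v j)).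
Proof.
move=> M0 l0 w0 wsym wii wexch wM.
pose u i j := w i j / (l i * l j).
have ll i j : i \in A -> j \in A -> 0 < l i * l j by move=> iA jA; rewrite mulr_gt0 ?l0.
have -> : M * (\sum_(i in A) l i * v i) ^+ 2
          - \sum_(i in A) \sum_(j in A) w i j * (v i * v j) =
          \sum_(i in A) \sum_(j in A) (M - u i j) * ((l i * v i) * (l j * v j)).
  rewrite expr2 mulr_suml mulr_sumr -sumrB; apply: eq_bigr => i iA.
  rewrite mulr_sumr mulr_sumr -sumrB; apply: eq_bigr => j jA.
  have := l0 i iA; have := l0 j jA; rewrite /u => lj li.
  by field; rewrite !gt_eqF.
apply: ultrametric_form => //.
- move=> i j iA jA; apply/andP; split.
    by rewrite subr_ge0 /u ler_pdivrMr ?ll ?wM.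
  by rewrite gerBl /u divr_ge0 // ltW ?ll.
- by move=> i iA; rewrite /u wii mul0r subr0.
- by move=> i j iA jA; rewrite /u wsym (mulrC (l i)).
move=> i j k iA jA kA; rewrite ge_min !lerD2l !lerN2 /u.
have := l0 i iA; have := l0 j jA; have := l0 k kA => lk lj li.
apply/orP; case: (wexch i j k) => ex; [left|right].
  rewrite ler_pdivrMr ?ll // mulrAC ler_pdivlMr ?ll //.
  have -> : w i j * (l i * l k) = l i * (w i j * l k) by ring.
  have -> : w i k * (l i * l j) = l i * (l j * w i k) by ring.
  by rewrite ler_pM2l.
rewrite ler_pdivrMr ?ll // mulrAC ler_pdivlMr ?ll //.
have -> : w i j * (l k * l j) = l j * (w i j * l k) by ring.
have -> : w k j * (l i * l j) = l j * (l i * w j k) by rewrite (wsym k j); ring.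
by rewrite ler_pM2l.
Qed.

(** This is [exchange_form] with [M = 1 / w0] on the support of [l], off which the bound on
    [w i j * w0] makes [w] vanish. Raising [#|A|] to [m] is harmless because the bracket is
    nonnegative. *)
Lemma exchange_form_bounded (R : realFieldType) (T : finType) (w0 : R)
    (l : T -> R) (w : T -> T -> R) (m : nat) (v : T -> R) :
  0 < w0 -> (forall i, 0 <= l i) ->
  (forall i j, 0 <= w i j) -> (forall i j, w i j = w j i) -> (forall i, w i i = 0) ->
  (forall i j k, w i j * l k <= l j * w i k \/ w i j * l k <= l i * w j k) ->
  (forall i j, w i j * w0 <= l i * l j) ->
  (#|[set i | (0 < l i)%R]| <= m)%N ->
  (\sum_i l i * v i) ^+ 2 <=
    m%:R * ((\sum_i l i * v i) ^+ 2 - w0 * \sum_i \sum_j w i j * (v i * v j)).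
Proof.
move=> w00 l0 wp wsym wii wexch wl; set A := [set i | _] => Am.
have lA i : i \notin A -> l i = 0.
  by rewrite inE -leNgt => li; apply/eqP; rewrite eq_le li l0.
have wA i j : i \notin A -> w i j = 0.
  move=> /lA li; apply/eqP; rewrite eq_le wp andbT.
  by have := wl i j; rewrite li mul0r pmulr_lle0.
have sumA (F : T -> R) : (forall i, i \notin A -> F i = 0) -> \sum_i F i = \sum_(i in A) F i.
  by move=> F0; rewrite (bigID (mem A)) /= [X in _ + X]big1 ?addr0.
rewrite sumA => [|i /lA ->]; last by rewrite mul0r.
rewrite [X in w0 * X]sumA => [|i iA]; last by rewrite big1 // => j _; rewrite wA ?mul0r.
have -> : \sum_(i in A) \sum_j w i j * (v i * v j) =
          \sum_(i in A) \sum_(j in A) w i j * (v i * v j).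
  by apply: eq_bigr => i _; apply: sumA => j jA; rewrite wsym wA ?mul0r.
have := @exchange_form R T A l w w0^-1 v _ _ wp wsym wii wexch.
set L := \sum_(i in A) l i * v i; set Q := \sum_(i in A) _ => H.
have {H} : w0^-1 * L ^+ 2 <= #|A|%:R * (w0^-1 * L ^+ 2 - Q).
  apply: H => [|i|i j _ _]; first by rewrite invr_ge0 ltW.
    by rewrite inE.
  by rewrite mulrC ler_pdivlMr.
have -> : w0^-1 * L ^+ 2 - Q = w0^-1 * (L ^+ 2 - w0 * Q) by field; rewrite gt_eqF.
set X := L ^+ 2 - w0 * Q.
rewrite (mulrCA _ w0^-1 X) ler_pM2l ?invr_gt0 // => leL.
(* The sign of [X] comes from dividing [leL] by [#|A|], so an empty [A], where [X = 0], is treated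
   apart. *)
have [A0|A0] := eqVneq #|A| 0%N.
  move: leL; rewrite A0 mul0r => leL; move/eqP: A0; rewrite cards_eq0 => /eqP A0.
  by rewrite /X /Q /L A0 !big_set0 mulr0 subr0 expr0n mulr0.
apply: (le_trans leL); apply: ler_wpM2r; last by rewrite ler_nat.
rewrite -(@pmulr_rge0 _ #|A|%:R) ?ltr0n ?lt0n //.
exact: le_trans (sqr_ge0 _) leL.
Qed.

(** On the hyperplane orthogonal to [l] the square in [exchange_form] disappears, so any [M]
    bounding the ratios [w i j / (l i * l j)] will do. For [i] outside the support of [l], exchange
    makes row [i] of [w] proportional to [l], so that it annihilates [v]. *)
Lemma exchange_form_nonpositive (R : realFieldType) (T : finType)
    (l : T -> R) (w : T -> T -> R) (v : T -> R) :
  (forall i, 0 <= l i) ->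
  (forall i j, 0 <= w i j) -> (forall i j, w i j = w j i) -> (forall i, w i i = 0) ->
  (forall i j k, w i j * l k <= l j * w i k \/ w i j * l k <= l i * w j k) ->
  (exists k, 0 < l k) ->
  \sum_i l i * v i = 0 ->
  \sum_i \sum_j w i j * (v i * v j) <= 0.
Proof.
move=> l0 wp wsym wii wexch [k lk] Lv.
pose A := [set i | 0 < l i].
have lA i : i \notin A -> l i = 0.
  by rewrite inE -leNgt => li; apply/eqP; rewrite eq_le li l0.
have sumA (F : T -> R) : (forall i, i \notin A -> F i = 0) -> \sum_i F i = \sum_(i in A) F i.
  by move=> F0; rewrite (bigID (mem A)) /= [X in _ + X]big1 ?addr0.
(* With [l i = 0] one alternative of the exchange is a bound by 0; swapping [j] and [k] gives the
   reverse inequality. *)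
have wlk i j : l i = 0 -> w i j * l k = l j * w i k.
  move=> li; apply/eqP; rewrite eq_le; apply/andP; split.
    case: (wexch i j k) => // /le_trans; apply; rewrite li mul0r.
    by rewrite mulr_ge0.
  rewrite mulrC (mulrC (w i j)); case: (wexch i k j) => // /le_trans; apply.
  by rewrite li mul0r mulr_ge0.
have wAA i j : i \notin A -> j \notin A -> w i j = 0.
  move=> /lA li /lA lj; apply: (mulIf (lt0r_neq0 lk)).
  by rewrite mul0r wlk // lj mul0r.
have row i : i \notin A -> \sum_j w i j * v j = 0.
  move=> /lA li.
  apply: (mulIf (lt0r_neq0 lk)); rewrite mul0r mulr_suml.
  transitivity (w i k * \sum_j l j * v j); last by rewrite Lv mulr0.
  rewrite mulr_sumr; apply: eq_bigr => j _.
  by rewrite mulrAC wlk //; ring.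
rewrite sumA => [|i /row wi]; last first.
  transitivity (v i * \sum_j w i j * v j); last by rewrite wi mulr0.
  by rewrite mulr_sumr; apply: eq_bigr => j _; ring.
have -> : \sum_(i in A) \sum_j w i j * (v i * v j) =
          \sum_(i in A) \sum_(j in A) w i j * (v i * v j).
  rewrite exchange_big [RHS]exchange_big /=.
  rewrite [LHS]sumA // => j jA.
  transitivity (v j * \sum_(i in A) w j i * v i).
    by rewrite mulr_sumr; apply: eq_bigr => i _; rewrite (wsym j); ring.
  by rewrite -sumA ?row ?mulr0 // => i iA; rewrite wAA ?mul0r.
pose M := \sum_(i in A) \sum_(j in A) w i j / (l i * l j).
have ll i j : i \in A -> j \in A -> 0 < l i * l j.
  by rewrite !inE => li lj; rewrite mulr_gt0.
have M0 : 0 <= M.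
  by apply: sumr_ge0 => i iA; apply: sumr_ge0 => j jA; rewrite divr_ge0 // ltW ?ll.
have := @exchange_form R T A l w M v M0 _ wp wsym wii wexch.
rewrite -sumA => [|i /lA ->]; last by rewrite mul0r.
rewrite Lv expr0n mulr0 sub0r; set Q := \sum_(i in A) _ => H.
have {H} : 0 <= #|A|%:R * - Q.
  apply: H => [i|i j iA jA]; first by rewrite inE.
  rewrite -ler_pdivrMr ?ll // /M (bigD1 i) //= (bigD1 j) //= -addrA lerDl.
  rewrite addr_ge0 //; last apply: sumr_ge0 => i' /andP[i'A _].
    by apply: sumr_ge0 => j' /andP[j'A _]; rewrite divr_ge0 // ltW ?ll.
  by apply: sumr_ge0 => j' j'A; rewrite divr_ge0 // ltW ?ll.
rewrite pmulr_rge0 ?oppr_ge0 // ltr0n; apply/card_gt0P; exists k.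
by rewrite inE.
Qed.

(** * Weights with the exchange property and their supports *)

Definition Mnat_weight (R : realFieldType) (E : finType) (w : {set E} -> R) :=
  (forall I, 0 <= w I) /\
  forall (I1 I2 : {set E}) (i1 : E), i1 \in I1 :\: I2 ->
    w I1 * w I2 <= w (I1 :\ i1) * w (i1 |: I2) \/
    exists2 i2, i2 \in I2 :\: I1 &
      w I1 * w I2 <= w (i2 |: (I1 :\ i1)) * w (i1 |: (I2 :\ i2)).

Lemma exchange_support (R : realFieldType) (E : finType) (w : {set E} -> R)
    (X Y : {set E}) (x : E) :
  Mnat_weight w -> 0 < w X -> 0 < w Y -> x \in X :\: Y ->
  0 < w (X :\ x) /\ 0 < w (x |: Y) \/
  exists2 y, y \in Y :\: X & 0 < w (y |: (X :\ x)).
Proof.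
move=> [w0 wex] X0 Y0 /wex ex; have XY : 0 < w X * w Y by rewrite mulr_gt0.
case: ex => [/(lt_le_trans XY) lt|[y yYX /(lt_le_trans XY) lt]].
  left; split; rewrite lt_def w0 andbT; apply: contraTneq lt => ->.
    by rewrite mul0r ltxx.
  by rewrite mulr0 ltxx.
right; exists y => //; rewrite lt_def w0 andbT; apply: contraTneq lt => ->.
by rewrite mul0r ltxx.
Qed.

(** Exchanging some [x] of [X :\: Y] either augments [Y] at once or replaces [X] by [y |: (X :\ x)],
    of the same size and closer to [Y]; hence the induction on [#|X :\: Y|]. *)
Lemma augmentation (R : realFieldType) (E : finType) (w : {set E} -> R)
    (X Y : {set E}) :
  Mnat_weight w -> 0 < w X -> 0 < w Y -> (#|Y| < #|X|)%N ->
  exists2 x, x \in X :\: Y & 0 < w (x |: Y).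
Proof.
move=> wP; have [N] := ubnP #|X :\: Y|.
elim: N => // N IHN in X *; rewrite ltnS => cardN X0 Y0 ltYX.
have [x xXY] : exists x, x \in X :\: Y.
  apply/set0Pn; rewrite setD_eq0; apply: contraTN ltYX => /subset_leq_card.
  by rewrite -leqNgt.
have [[_ ?]|[y yYX yX0]] := exchange_support wP X0 Y0 xXY; first by exists x.
move: (xXY) (yYX); rewrite !inE => /andP[xY xX] /andP[yX yY].
have sub : (y |: (X :\ x)) :\: Y \subset (X :\: Y) :\ x.
  apply/subsetP => z; rewrite !inE => /andP[zY /orP[/eqP zy|/andP[-> ->]]].
    by rewrite zy yY in zY.
  by rewrite zY.
have cardX' : (#|(y |: (X :\ x)) :\: Y| < N)%N.
  rewrite (leq_trans _ cardN) // (cardsD1 x (X :\: Y)) xXY.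
  exact: subset_leq_card.
have ltYX' : (#|Y| < #|y |: (X :\ x)|)%N.
  by move: ltYX; rewrite cardsU1 !inE (negPf yX) andbF (cardsD1 x X) xX.
have [z zX zY0] := IHN _ cardX' yX0 Y0 ltYX'.
exists z => //; have /subsetP/(_ z zX) := sub.
by rewrite inE => /andP[].
Qed.

Lemma extension (R : realFieldType) (E : finType) (w : {set E} -> R)
    (X Y : {set E}) :
  Mnat_weight w -> 0 < w X -> 0 < w Y -> (#|Y| <= #|X|)%N ->
  exists2 Z : {set E}, Y \subset Z & #|Z| = #|X| /\ 0 < w Z.
Proof.
move=> wP X0; have [N] := ubnP (#|X| - #|Y|)%N.
elim: N => // N IHN in Y *; rewrite ltnS => cardN Y0.
rewrite leq_eqVlt => /orP[/eqP YX|ltYX]; first by exists Y.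
have [x] := augmentation wP X0 Y0 ltYX; rewrite inE => /andP[xY _] xY0.
have cardxY : #|x |: Y| = #|Y|.+1 by rewrite cardsU1 xY.
have [||Z YZ ZP] := IHN (x |: Y) _ xY0; rewrite ?cardxY //; first lia.
by exists Z => //; apply: subset_trans YZ; exact: subsetUr.
Qed.

(* Any two vertices [i] and [j] of the link of [S] have a common neighbour [k]. *)
Lemma exchange_connected (R : realFieldType) (E : finType) (w : {set E} -> R)
    (S I J : {set E}) (i j : E) :
  Mnat_weight w -> 0 < w I -> 0 < w J -> #|I| = #|J| -> (#|S|.+1 < #|I|)%N ->
  S \subset I -> S \subset J -> i \in I :\: S -> j \in J :\: S ->
  exists I' k, [/\ 0 < w I', #|I'| = #|I|, S \subset I', i \in I' & k \in I' :&: J :\: S].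
Proof.
move=> wP I0 J0 eIJ ltSI SI SJ /setDP[iI iS] jJS.
have [IJ0|[k kIJ]] := set_0Vmem (I :&: J :\: S); last by exists I, k.
have [i1] : exists i1, i1 \in I :\: S :\ i.
  apply/card_gt0P; have := cardsD1 i (I :\: S); rewrite inE iS iI /=.
  have := cardsDS SI; lia.
rewrite !inE => /and3P[i1i i1S i1I].
have i1J : i1 \notin J.
  by apply/negP => i1J; have /setP/(_ i1) := IJ0; rewrite !inE i1S i1I i1J.
have i1IJ : i1 \in I :\: J by rewrite inE i1J.
(* Exchange may shrink [I] to [I :\ i1] without replacement; then the larger [J] augments it, by an
   element other than [i1] since [i1 \notin J]. *)
have [y /setDP[yJ yI] y0] : exists2 y, y \in J :\: I & 0 < w (y |: (I :\ i1)).
  have [[I1 _]|//] := exchange_support wP I0 J0 i1IJ.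
  have [|y] := augmentation wP J0 I1; first by rewrite -eIJ (cardsD1 i1 I) i1I.
  rewrite !inE negb_and negbK => /andP[/orP[/eqP ->|yI] yJ] y0.
    by rewrite yJ in i1J.
  by exists y => //; rewrite inE yI.
exists (y |: (I :\ i1)), y; split=> //.
- by rewrite cardsU1 !inE (negPf yI) andbF (cardsD1 i1 I) i1I.
- apply/subsetP => z zS; rewrite !inE (subsetP SI) // andbT.
  by apply/orP; right; apply: contraNneq i1S => <-.
- by rewrite !inE iI andbT [i == i1]eq_sym i1i orbT.
by rewrite !inE eqxx yJ !andbT; apply: contra yI => /(subsetP SI).
Qed.

(** * Superset sums, gradients and Hessians *)

(** The derivative along [S] of the degree-[c] part of [sum_I w(I) x^I], at [x_i = 1]. *)
Definition wsum (R : realFieldType) (E : finType) (w : {set E} -> R) (S : {set E}) (c : nat) : R :=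
  \sum_(I : {set E} | (S \subset I) && (#|I| == c)) w I.

Lemma wsum_ge0 (R : realFieldType) (E : finType) (w : {set E} -> R) S c :
  Mnat_weight w -> 0 <= wsum w S c.
Proof. by move=> [w0 _]; exact: sumr_ge0. Qed.

Lemma wsum_gt0P (R : realFieldType) (E : finType) (w : {set E} -> R) (S : {set E}) c :
  Mnat_weight w ->
  reflect (exists I : {set E}, [/\ S \subset I, #|I| = c & 0 < w I]) (0 < wsum w S c).
Proof.
move=> [w0 _]; apply: (iffP idP) => [|[I [SI cI wI]]].
  rewrite lt_def => /andP[W0 _].
  have [I /andP[/andP[SI /eqP cI] wI]|none] :=
    pickP (fun I : {set E} => (S \subset I) && (#|I| == c) && (0 < w I)).
    by exists I.
  case/eqP: W0; apply: big1 => I SIc; apply/eqP; rewrite eq_le w0 andbT leNgt.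
  by have := none I; rewrite SIc /= => ->.
rewrite /wsum (bigD1 I) /=; last by rewrite SI cI eqxx.
by rewrite ltr_pwDl // sumr_ge0.
Qed.

Lemma wsum_card (R : realFieldType) (E : finType) (w : {set E} -> R) (S : {set E}) :
  wsum w S #|S| = w S.
Proof.
rewrite /wsum (big_pred1 S) // => I; apply/andP/eqP => [[SI /eqP cI]|->//].
by apply/eqP; rewrite eq_sym eqEcard SI cI leqnn.
Qed.

(** Euler's identity at the all-ones point, by double counting: a set [I] containing [S] occurs once
    for each element of [I :\: S]. *)
Lemma sum_wsum (R : realFieldType) (E : finType) (w : {set E} -> R) (S : {set E}) c :
  \sum_(i | i \notin S) wsum w (i |: S) c = (c - #|S|)%:R * wsum w S c.
Proof.
rewrite /wsum mulr_sumr.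
rewrite (exchange_big_dep (fun I : {set E} => (S \subset I) && (#|I| == c))) /=; last first.
  by move=> i I _; rewrite subUset => /andP[/andP[_ ->] ->].
apply: eq_bigr => I /andP[SI /eqP cI].
transitivity (\sum_(i in I :\: S) w I).
  apply: eq_bigl => i; rewrite !inE subUset sub1set SI cI eqxx !andbT.
  by case: (i \in S).
by rewrite sumr_const cardsDS // cI mulr_natl.
Qed.

(* Up to a constant factor and a rescaling of [x_0], the Hessian at [x_0 = 0],
   [x_i = 1] of the derivative along [S] and [n - K - 2] times along [x_0] of
   [sum_I w(I) x_0^(n-|I|) x^I], for [a = 1 + 1/(n - K - 1)]. *)
Definition hess (R : realFieldType) (E : finType) (w : {set E} -> R) (a : R) (K : nat)
    (S : {set E}) (i j : option E) : R :=
  match i, j with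
  | None, None => a * wsum w S K
  | None, Some i | Some i, None => if i \in S then 0 else wsum w (i |: S) K.+1
  | Some i, Some j =>
      if [|| i \in S, j \in S | i == j] then 0 else wsum w (i |: (j |: S)) K.+2
  end.

(** The gradient at the same point and in the same normalisation as [hess]. Entries in [S] are 0
    because the polynomial, affine in each [x_i], has lost these variables. *)
Definition hgrad (R : realFieldType) (E : finType) (w : {set E} -> R) (K : nat)
    (S : {set E}) (i : option E) : R :=
  match i with
  | None => wsum w S K.+1
  | Some i => if i \in S then 0 else wsum w (i |: S) K.+2
  end.

Lemma hess_sym (R : realFieldType) (E : finType) (w : {set E} -> R) (a : R) K S i j :
  hess w a K S i j = hess w a K S j i.
Proof.
by case: i j => [i|] [j|] //=; rewrite eq_sym setUCA; case: (i \in S); case: (j \in S).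
Qed.

Lemma hess_ge0 (R : realFieldType) (E : finType) (w : {set E} -> R) (a : R) K S i j :
  Mnat_weight w -> 0 <= a -> 0 <= hess w a K S i j.
Proof.
move=> wP a0; case: i j => [i|] [j|] /=; rewrite ?mulr_ge0 ?wsum_ge0 //;
  by case: ifP => // _; rewrite wsum_ge0.
Qed.

Lemma sum_if0 (R : realFieldType) (T : finType) (P : pred T) (F : T -> R) :
  \sum_i (if P i then 0 else F i) = \sum_(i | ~~ P i) F i.
Proof. by rewrite [RHS]big_mkcond; apply: eq_bigr => i _; case: (P i). Qed.

(** Euler's identity for the gradient, homogeneous of degree [K + 1 - #|S|]. The index [None] is
    absent from the sum because [x_0 = 0]. *)
Lemma hgradE (R : realFieldType) (E : finType) (w : {set E} -> R) (a : R) K S i :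
  \sum_j hess w a K S i (Some j) = (K.+1 - #|S|)%:R * hgrad w K S i.
Proof.
case: i => [i|] /=; last by rewrite sum_if0 sum_wsum.
case: ifP => [iS|iS]; first by rewrite big1 ?mulr0.
have cardiS : #|i |: S| = #|S|.+1 by rewrite cardsU1 iS.
rewrite -subSS -cardiS -sum_wsum -sum_if0.
apply: eq_bigr => j _; rewrite !inE (eq_sym i) [i |: _]setUCA.
by case: (j == i); case: (j \in S).
Qed.

Lemma hgrad_contract (R : realFieldType) (E : finType) (w : {set E} -> R) (a : R) K
    (S : {set E}) (i : E) j :
  i \notin S -> hgrad w K (i |: S) j = hess w a K S (Some i) j.
Proof.
move=> iS; case: j => [j|] /=; rewrite (negPf iS) //=.
by rewrite !inE orbC (eq_sym i) setUCA.
Qed.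

Lemma hess_euler (R : realFieldType) (E : finType) (w : {set E} -> R) (a : R) K
    (S : {set E}) j l :
  \sum_(i | i \notin S) hess w a K (i |: S) j l = (K - #|S|)%:R * hess w a K S j l.
Proof.
have euler1 (k : E) : \sum_(i | i \notin S) hess w a K (i |: S) None (Some k) =
    (K - #|S|)%:R * hess w a K S None (Some k).
  rewrite /=; case: ifP => [kS|kS].
    by rewrite big1 ?mulr0 // => i _; rewrite !inE kS orbT.
  have cardkS : #|k |: S| = #|S|.+1 by rewrite cardsU1 kS.
  rewrite -subSS -cardkS -sum_wsum.
  rewrite -!sum_if0; apply: eq_bigr => i _; rewrite !inE (eq_sym k) setUCA kS.
  by case: (i \in S); case: (i == k).
case: j l => [j|] [l|].
- rewrite /=; case: ifP => [jl|jl].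
    rewrite big1 ?mulr0 // => i _; rewrite !inE.
    by case/or3P: jl => ->; rewrite ?orbT.
  move/negbT: jl; rewrite !negb_or => /and3P[jS lS jl].
  have <- : (K.+2 - #|j |: (l |: S)| = K - #|S|)%N.
    by rewrite !cardsU1 !inE (negPf jl) jS lS; lia.
  rewrite -sum_wsum -!sum_if0; apply: eq_bigr => i _.
  rewrite !inE (negPf jS) (negPf lS) (negPf jl) !orbF (eq_sym j) (eq_sym l).
  rewrite (setUCA [set i] [set j]) (setUCA [set i] [set l]).
  by case: (i \in S); case: (i == j); case: (i == l).
- by under eq_bigr do rewrite hess_sym; rewrite euler1 hess_sym.
- exact: euler1.
by rewrite /= -mulr_sumr sum_wsum; ring.
Qed.

Definition unit_point (R : realFieldType) (E : finType) (o : option E) : R :=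
  (o != None)%:R.

Lemma hess_unit_point (R : realFieldType) (E : finType) (w : {set E} -> R) (a : R) K
    (S : {set E}) v :
  dot (@unit_point R E) (ap (hess w a K S) v) =
  (K.+1 - #|S|)%:R * dot v (hgrad w K S).
Proof.
rewrite dot_apC; last exact: hess_sym.
rewrite /dot mulr_sumr; apply: eq_bigr => i _.
rewrite mulrCA -(hgradE w a); congr (_ * _); rewrite /ap sum_option mulr0 add0r.
by apply: eq_bigr => j _; rewrite mulr1.
Qed.

Lemma dot_unit_point (R : realFieldType) (E : finType) (w : {set E} -> R) K
    (S : {set E}) :
  dot (@unit_point R E) (hgrad w K S) = (K.+2 - #|S|)%:R * wsum w S K.+2.
Proof.
rewrite /dot sum_option mul0r add0r -sum_wsum -sum_if0.
by apply: eq_bigr => i _; rewrite mul1r.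
Qed.

(** By Euler's identity, used twice, the form at [unit_point] is [(K + 1 - #|S|) (K + 2 - #|S|)]
    times [wsum w S K.+2]; one factor [K + 1 - #|S|] cancels. If the sum vanishes, so does the left
    side, hence a hyperplane is asked for only when it is positive. *)
Lemma hess_reversed_cauchy_schwarz (R : realFieldType) (E : finType) (w : {set E} -> R)
    (a : R) K (S : {set E}) :
  Mnat_weight w -> (#|S| <= K)%N ->
  (0 < wsum w S K.+2 ->
    exists b, forall v, dot v b = 0 -> dot v (ap (hess w a K S) v) <= 0) ->
  forall v, dot v (ap (hess w a K S) v) * ((K.+2 - #|S|)%:R * wsum w S K.+2)
    <= (K.+1 - #|S|)%:R * dot v (hgrad w K S) ^+ 2.
Proof.
move=> wP SK neg v.
have [W0|W0] := eqVneq (wsum w S K.+2) 0.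
  by rewrite W0 !mulr0 mulr_ge0 ?sqr_ge0.
have {W0} W0 : 0 < wsum w S K.+2 by rewrite lt_def W0 wsum_ge0.
have [b Hb] := neg W0.
have d1 : 0 < (K.+1 - #|S|)%:R :> R by rewrite ltr0n subn_gt0 ltnS.
have d2 : 0 < (K.+2 - #|S|)%:R :> R by rewrite ltr0n subn_gt0 ltnS leqW.
have := reversed_cauchy_schwarz (x := @unit_point R E) (hess_sym w a K S) Hb.
rewrite !hess_unit_point dot_unit_point => rcs.
have {rcs} /rcs/(_ v) : 0 < (K.+1 - #|S|)%:R * ((K.+2 - #|S|)%:R * wsum w S K.+2).
  by rewrite !mulr_gt0.
rewrite hess_unit_point exprMn mulrCA expr2 -[X in _ <= X]mulrA ler_pM2l //.
Qed.

Lemma hess_form (R : realFieldType) (E : finType) (w : {set E} -> R) (a : R) K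
    (S : {set E}) v :
  dot v (ap (hess w a K S) v) =
  a * wsum w S K * v None ^+ 2
  + (v None * \sum_i hess w a K S None (Some i) * v (Some i)) *+ 2
  + \sum_i \sum_j hess w a K S (Some i) (Some j) * (v (Some i) * v (Some j)).
Proof.
have -> : a * wsum w S K = hess w a K S None None by [].
move: (hess w a K S) (hess_sym w a K S) => H Hsym.
have rowE i : ap H v i = H i None * v None + \sum_j H i (Some j) * v (Some j).
  by rewrite /ap sum_option.
rewrite /dot sum_option rowE.
have -> : \sum_i v (Some i) * ap H v (Some i) =
    v None * \sum_i H None (Some i) * v (Some i)
    + \sum_i \sum_j H (Some i) (Some j) * (v (Some i) * v (Some j)).
  rewrite mulr_sumr -big_split; apply: eq_bigr => i _ /=.
  rewrite rowE mulrDr mulr_sumr (Hsym None); congr (_ + _); first ring.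
  by apply: eq_bigr => j _; ring.
ring.
Qed.

(** * Nonpositivity on a hyperplane: quadratic case and inductive step *)

(** There are three choices of [b]. If [w S > 0], it is row [None] of the Hessian, with
    [exchange_form_bounded]. If [w S = 0] but some [l k > 0], it is [l], with
    [exchange_form_nonpositive]. If [l] vanishes too, only the block [u] of the form remains, and
    one of its rows replaces [l]. *)
Lemma hess_two_nonpositive (R : realFieldType) (E : finType) (w : {set E} -> R)
    (a : R) (S : {set E}) :
  Mnat_weight w -> 0 < a -> a * (#|E| - #|S| - 1)%:R <= (#|E| - #|S|)%:R ->
  (#|S|.+1 < #|E|)%N ->
  0 < wsum w S #|S|.+2 ->
  exists b, forall v, dot v b = 0 -> dot v (ap (hess w a #|S| S) v) <= 0.
Proof.
move=> wP a0 am SE W0; have [w0 wex] := wP.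
pose l i := hess w a #|S| S None (Some i).
pose u i j := hess w a #|S| S (Some i) (Some j).
have l0 i : 0 <= l i by rewrite hess_ge0 // ltW.
have u0 i j : 0 <= u i j by rewrite hess_ge0 // ltW.
have usym i j : u i j = u j i by exact: hess_sym.
have uii i : u i i = 0 by rewrite /u /= eqxx !orbT.
have lS i : i \in S -> l i = 0 by rewrite /l /= => ->.
have uS i j : i \in S -> u i j = 0 by rewrite /u /= => ->.
have lE i : i \notin S -> l i = w (i |: S).
  move=> iS; rewrite /l /= (negPf iS).
  by have <- : #|i |: S| = #|S|.+1; [rewrite cardsU1 iS | exact: wsum_card].
have uE i j : i \notin S -> j \notin S -> i != j -> u i j = w (i |: (j |: S)).
  move=> iS jS ij; rewrite /u /= (negPf iS) (negPf jS) (negPf ij) /=.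
  have <- : #|i |: (j |: S)| = #|S|.+2 by rewrite !cardsU1 !inE (negPf ij) iS jS.
  exact: wsum_card.
have uSr i j : j \in S -> u i j = 0 by move=> jS; rewrite usym uS.
have notin2 i j : i \notin S -> i != j -> i \notin j |: S.
  by move=> iS ij; rewrite !inE (negPf ij).
have uls i j k : u i j * l k <= l j * u i k \/ u i j * l k <= l i * u j k.
  have zero : u i j * l k = 0 -> u i j * l k <= l j * u i k \/ u i j * l k <= l i * u j k.
    by move=> ->; left; rewrite mulr_ge0.
  case: (boolP (i \in S)) => [iS|iS]; first by apply: zero; rewrite uS ?mul0r.
  case: (boolP (j \in S)) => [jS|jS]; first by apply: zero; rewrite uSr ?mul0r.
  case: (boolP (k \in S)) => [kS|kS]; first by apply: zero; rewrite lS ?mulr0.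
  have [ij|ij] := eqVneq i j; first by apply: zero; rewrite ij uii mul0r.
  have [->|ki] := eqVneq k i; first by right; rewrite mulrC (usym i).
  have [->|kj] := eqVneq k j; first by left; rewrite mulrC.
  rewrite !lE // !uE // 1?eq_sym //.
  have := wex (i |: (j |: S)) (k |: S) i.
  rewrite setU1K ?notin2 // !inE eqxx (negPf iS) (eq_sym i) (negPf ki) => /(_ isT).
  case=> [|[i2]]; first by left.
  rewrite !inE !negb_or => /andP[/and3P[_ _ i2S]]; rewrite (negPf i2S) orbF => /eqP ->.
  by rewrite setU1K // => le; right; rewrite [X in _ <= X]mulrC (setUCA [set j]).
have ul i j : u i j * w S <= l i * l j.
  case: (boolP (i \in S)) => [iS|iS]; first by rewrite uS // mul0r mulr_ge0.
  case: (boolP (j \in S)) => [jS|jS]; first by rewrite uSr // mul0r mulr_ge0.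
  have [->|ij] := eqVneq i j; first by rewrite uii mul0r mulr_ge0.
  rewrite !lE // uE //; have := wex (i |: (j |: S)) S i.
  rewrite setU1K ?notin2 // !inE eqxx (negPf iS) => /(_ isT) [|[i2]].
    by rewrite [X in _ <= X -> _]mulrC.
  by rewrite !inE => /andP[/norP[_ /norP[_ /negPf ->]]].
have [wS0|wS] := eqVneq (w S) 0; last first.
  have {wS} wS : 0 < w S by rewrite lt_def wS w0.
  have lm : (#|[set i | (0 < l i)%R]| <= #|E| - #|S|)%N.
    have <- : #|~: S| = (#|E| - #|S|)%N by rewrite cardsCs setCK.
    apply: subset_leq_card; apply/subsetP => i.
    by rewrite !inE; apply: contraTN => /lS ->; rewrite ltxx.
  exists (fun o => if o is Some i then l i else a * w S) => v.
  move=> vb.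
  have {vb} : v None * (a * w S) + \sum_i l i * v (Some i) = 0.
    apply: etrans vb; rewrite /dot sum_option; congr (_ + _).
    by apply: eq_bigr => i _; rewrite mulrC.
  rewrite hess_form wsum_card.
  have := @exchange_form_bounded R E (w S) l u _ (fun i => v (Some i)) wS l0 u0 usym uii uls ul lm.
  rewrite -[\sum_i \sum_j hess _ _ _ _ _ _ * _]/(\sum_i \sum_j u i j * _).
  rewrite -[\sum_i hess _ _ _ _ _ _ * _]/(\sum_i l i * _).
  move: (\sum_i l i * _) (\sum_i \sum_j _) (v None) => L Q y ineq /eqP.
  rewrite addrC addr_eq0 => /eqP LE; move: ineq; rewrite LE.
  have [m mE] : exists m, (#|E| - #|S|)%N = m.+1 by exists (#|E| - #|S|).-1; lia.
  rewrite mE; move: am; rewrite mE subn1 /= -natr1 sqrrN.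
  set M := m%:R => am ineq.
  have M0 : 0 <= M by rewrite ler0n.
  have M1 : 0 < M + 1 by lra.
  (* On the hyperplane [L = - y a w(S)], so the form is [Q - a w(S) y^2]. The ultrametric bound
     gives [Q1], and [a M <= M + 1], where [M + 1 = #|E| - #|S|], gives [Q2]: this is what limits
     the constant [a]. *)
  have Q1 : (M + 1) * w S * Q <= M * a * (a * (w S * y) ^+ 2).
    have -> : M * a * (a * (w S * y) ^+ 2) = M * (y * (a * w S)) ^+ 2 by ring.
    by move: ineq; set Z := (_ ^+ 2); lra.
  have Q2 : M * a * (a * (w S * y) ^+ 2) <= (M + 1) * (a * (w S * y) ^+ 2).
    by rewrite [M * a]mulrC ler_wpM2r // mulr_ge0 ?sqr_ge0 // ltW.
  have : (M + 1) * w S * Q <= (M + 1) * w S * (a * w S * y ^+ 2).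
    apply: le_trans Q1 (le_trans Q2 _).
    by rewrite le_eqVlt; apply/orP; left; apply/eqP; ring.
  rewrite ler_pM2l ?mulr_gt0 //; lra.
have formE v : dot v (ap (hess w a #|S| S) v) =
    (v None * \sum_i l i * v (Some i)) *+ 2
    + \sum_i \sum_j u i j * (v (Some i) * v (Some j)).
  by rewrite hess_form wsum_card wS0 mulr0 mul0r add0r.
have [k lk|nl] := pickP (fun k => 0 < l k).
  exists (fun o => if o is Some i then l i else 0) => v.
  rewrite formE => vl.
  have Lv : \sum_i l i * v (Some i) = 0.
    by apply: etrans vl; rewrite /dot sum_option mulr0 add0r; apply: eq_bigr => i _; rewrite mulrC.
  rewrite Lv mulr0 mul0rn add0r.
  by apply: (exchange_form_nonpositive l0 u0 usym uii uls _ Lv); exists k.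
have lz i : l i = 0 by apply/eqP; rewrite eq_le l0 andbT leNgt nl.
have [I [SI cI wI]] := wsum_gt0P _ _ wP W0.
have [p pIS] : exists p, p \in I :\: S.
  by apply/card_gt0P; rewrite cardsDS // cI; lia.
have [q] : exists q, q \in I :\: S :\ p.
  by apply/card_gt0P; have := cardsD1 p (I :\: S); rewrite pIS cardsDS // cI; lia.
rewrite !inE => /and3P[qp qS qI]; move: pIS; rewrite inE => /andP[pS pI].
have upq : 0 < u p q.
  rewrite uE // 1?eq_sym // (_ : p |: (q |: S) = I) //.
  apply/eqP; rewrite eqEcard !subUset !sub1set pI qI SI cI /=.
  by rewrite !cardsU1 !inE negb_or (eq_sym p) qp pS qS.
have upE i j k : u i j * u p k <= u p j * u i k \/ u i j * u p k <= u p i * u j k.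
  have zero : u i j * u p k = 0 -> u i j * u p k <= u p j * u i k \/ u i j * u p k <= u p i * u j k.
    by move=> ->; left; rewrite mulr_ge0.
  case: (boolP (i \in S)) => [iS|iS]; first by apply: zero; rewrite uS ?mul0r.
  case: (boolP (j \in S)) => [jS|jS]; first by apply: zero; rewrite uSr ?mul0r.
  case: (boolP (k \in S)) => [kS|kS]; first by apply: zero; rewrite (uSr p) ?mulr0.
  have [ij|ij] := eqVneq i j; first by apply: zero; rewrite ij uii mul0r.
  have [pk|pk] := eqVneq p k; first by apply: zero; rewrite pk uii mulr0.
  have [->|ki] := eqVneq k i; first by right; rewrite mulrC (usym i).
  have [->|kj] := eqVneq k j; first by left; rewrite mulrC.
  have [->|pi] := eqVneq p i; first by left.
  have [->|pj] := eqVneq p j; first by right; rewrite (usym i).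
  (* All [w (m |: S)] are 0, so the alternative without replacement bounds the product by 0. The
     replacements [p] and [k] give the two alternatives of a relation in which row [p] of [u] acts
     as [l]. *)
  have lw m : m \notin S -> w (m |: S) = 0 by move=> mS; rewrite -lE.
  rewrite !uE // 1?eq_sym //.
  have := wex (i |: (j |: S)) (p |: (k |: S)) i.
  rewrite setU1K ?notin2 // !inE eqxx (negPf iS) (eq_sym i p) (negPf pi).
  rewrite (eq_sym i k) (negPf ki) lw // mul0r => /(_ isT).
  case=> [le|[i2]]; first by left; rewrite (le_trans le) // mulr_ge0.
  rewrite !inE !negb_or => /andP[/and3P[_ _ i2S]]; rewrite (negPf i2S) orbF.
  case/orP=> /eqP -> le; [left|right].
    by move: le; rewrite setU1K ?notin2.
  move: le; rewrite (setUCA [set p] [set k]) setU1K ?notin2 // 1?eq_sym //.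
  by rewrite [X in _ <= X -> _]mulrC (setUCA [set k] [set j]) (setUCA [set i] [set p]).
exists (fun o => if o is Some i then u p i else 0) => v.
rewrite formE => vu.
rewrite big1 => [|i _]; last by rewrite lz mul0r.
rewrite mulr0 mul0rn add0r.
apply: (exchange_form_nonpositive _ u0 usym uii upE) => //; first by exists q.
by apply: etrans vu; rewrite /dot sum_option mulr0 add0r; apply: eq_bigr => i _; rewrite mulrC.
Qed.

(** In contrapositive form: once the sum over [T'] vanishes at level [c], with [wsum w S c]
    positive, the sums above [T'] vanish at all lower levels too. *)
Lemma wsum_extension (R : realFieldType) (E : finType) (w : {set E} -> R)
    (S T T' : {set E}) c d :
  Mnat_weight w -> T' \subset T -> (d <= c)%N ->
  0 < wsum w S c -> 0 < wsum w T d -> 0 < wsum w T' c.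
Proof.
move=> wP T'T dc /wsum_gt0P-/(_ wP)[I [_ cI wI]] /wsum_gt0P-/(_ wP)[J [TJ cJ wJ]].
have [|Z JZ [cZ wZ]] := extension wP wI wJ; first by rewrite cJ cI.
by apply/wsum_gt0P => //; exists Z; rewrite cZ; split=> //; apply: subset_trans JZ; apply: subset_trans TJ.
Qed.

(** Summed over [i \notin S] with [hess_euler], the hypotheses give [H <= H D H] for
    [D i = 1 / b i], because by [hgrad_contract] the gradient at [i |: S] is row [i] of [H]. The
    supports of [w] supply the other conditions of [local_to_global]. *)
Lemma hess_step (R : realFieldType) (E : finType) (w : {set E} -> R) (a : R) K
    (S : {set E}) :
  Mnat_weight w -> 0 < a -> (#|S| < K)%N ->
  (forall i, i \notin S -> forall v,
     dot v (ap (hess w a K (i |: S)) v) * ((K.+1 - #|S|)%:R * wsum w (i |: S) K.+2)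
     <= (K - #|S|)%:R * dot v (hgrad w K (i |: S)) ^+ 2) ->
  0 < wsum w S K.+2 ->
  forall v, dot v (fun i => (K.+1 - #|S|)%:R * hgrad w K S i) = 0 ->
    dot v (ap (hess w a K S) v) <= 0.
Proof.
move=> wP a0 SK IH W0.
set H := hess w a K S; set b := fun i => _.
have H0 i j : 0 <= H i j by rewrite hess_ge0 // ltW.
have d0 : 0 < (K - #|S|)%:R :> R by rewrite ltr0n subn_gt0.
have d1 : 0 < (K.+1 - #|S|)%:R :> R by rewrite ltr0n subn_gt0 ltnS ltnW.
have bP i : 0 < b (Some i) -> i \notin S /\ 0 < wsum w (i |: S) K.+2.
  by rewrite /b /=; case: ifP; rewrite ?mulr0 ?ltxx // pmulr_rgt0.
have HP i j : i \notin S -> j \notin S -> i != j -> 0 < wsum w (i |: (j |: S)) K.+2 ->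
    0 < H (Some i) (Some j).
  by rewrite /H /= => /negPf -> /negPf -> /negPf ->.
apply: local_to_global => //.
- exact: hess_sym.
- by move=> i; rewrite hgradE.
- move=> v; rewrite -(ler_pM2l d0).
  have -> : (K - #|S|)%:R * dot v (ap H v) =
            \sum_(i | i \notin S) dot v (ap (hess w a K (i |: S)) v).
    rewrite /dot exchange_big mulr_sumr; apply: eq_bigr => j _ /=.
    rewrite -mulr_sumr mulrCA; congr (_ * _).
    rewrite /ap exchange_big mulr_sumr; apply: eq_bigr => l _ /=.
    by rewrite -mulr_suml hess_euler mulrA.
  rewrite mulr_sumr [X in X <= _]big_mkcond; apply: ler_sum => i _.
  have rhs0 : 0 <= (K - #|S|)%:R * ((b (Some i))^-1 * ap H v (Some i) ^+ 2).
    apply: mulr_ge0 (ltW d0) _; rewrite mulr_ge0 ?sqr_ge0 // invr_ge0.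
    by rewrite /b mulr_ge0 //=; case: ifP => // _; rewrite wsum_ge0.
  case: ifP => // iS.
  (* If this sum is 0, the hypothesis for [i] carries no information and [(b i)^-1] is 0, but by
     [wsum_extension] the whole Hessian at [i |: S] vanishes. *)
  have [Wi|Wi] := eqVneq (wsum w (i |: S) K.+2) 0.
    have zero (T : {set E}) c : i |: S \subset T -> (c <= K.+2)%N -> wsum w T c = 0.
      move=> iST cK; apply/eqP; rewrite eq_le wsum_ge0 // andbT leNgt.
      by apply/negP => /(wsum_extension wP iST cK W0); rewrite Wi ltxx.
    rewrite [X in X <= _]big1 // => j _; rewrite /ap big1 ?mulr0 // => l _.
    case: j l => [j|] [l|] /=; rewrite ?zero ?mulr0 ?mul0r ?if_same ?mul0r //;
      first [by rewrite !leqW | by apply/subsetP => z; rewrite !inE => ->; rewrite ?orbT].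
  have {}Wi : 0 < wsum w (i |: S) K.+2 by rewrite lt_def Wi wsum_ge0.
  have := IH i iS v.
  have -> : dot v (hgrad w K (i |: S)) = ap H v (Some i).
    rewrite dotC; apply: eq_bigr => j _; congr (_ * _).
    exact: hgrad_contract.
  rewrite -ler_pdivlMr ?mulr_gt0 // => /le_trans; apply.
  by rewrite /b /= (negPf iS) -mulrA [_ ^+ 2 / _]mulrC.
(* The set containing [i] is replaced by one containing both [i] and some [k] of [J] outside [S];
   this [k] is equal or adjacent to [i] and to [j]. *)
- move=> i j /bP[iS Wi] /bP[jS Wj].
  have [I [iSI cI wI]] := wsum_gt0P _ _ wP Wi.
  have [J [jSJ cJ wJ]] := wsum_gt0P _ _ wP Wj.
  move: iSI jSJ; rewrite !subUset !sub1set => /andP[iI SI] /andP[jJ SJ].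
  have [|||I' [k [wI' cI' SI' iI']]] :=
    exchange_connected (S := S) (i := i) (j := j) wP wI wJ (etrans cI (esym cJ)) _ SI SJ.
  + by rewrite cI !ltnS ltnW.
  + by rewrite inE iS.
  + by rewrite inE jS.
  rewrite !inE => /and3P[kS kI' kJ]; exists k; split.
    have [->|ik] := eqVneq i k; [by left|right]; apply: HP => //.
    apply/wsum_gt0P => //; exists I'; split; rewrite ?cI' //.
    by rewrite !subUset !sub1set iI' kI'.
  have [->|kj] := eqVneq k j; [by left|right]; apply: HP => //.
  apply/wsum_gt0P => //; exists J; split=> //.
  by rewrite !subUset !sub1set kJ jJ.
move=> j; rewrite /H /b /=; case: ifP => [_|jS Wj]; first by rewrite ltxx.
by rewrite pmulr_rgt0 //; apply: wsum_extension W0 Wj.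
Qed.

Lemma hess_log_concave (R : realFieldType) (E : finType) (w : {set E} -> R) (a : R) K
    (S : {set E}) :
  Mnat_weight w -> (K.+1 < #|E|)%N -> 0 < a ->
  a * (#|E| - K.+1)%:R <= (#|E| - K)%:R -> (#|S| <= K)%N ->
  forall v, dot v (ap (hess w a K S) v) * ((K.+2 - #|S|)%:R * wsum w S K.+2)
    <= (K.+1 - #|S|)%:R * dot v (hgrad w K S) ^+ 2.
Proof.
move=> wP KE a0 aE; have [N] := ubnP (K - #|S|); elim: N => // N IHN in S *.
rewrite ltnS => SN SK; apply: hess_reversed_cauchy_schwarz => // W0.
move: SK; rewrite leq_eqVlt => /orP[/eqP SK|SK].
  by rewrite -SK in KE aE W0 *; apply: hess_two_nonpositive; rewrite // -subnDA addn1.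
eexists; apply: hess_step => // i iS v.
have ciS : #|i |: S| = #|S|.+1 by rewrite cardsU1 iS.
by have := IHN (i |: S) _ _ v; rewrite ciS !subSS; apply => //; lia.
Qed.

(** At [S = set0] and [v = e_0] the form is [a * wsum w set0 K]. The factor [1 + 1 / (n - K - 1)] is
    [a], for which [aE] is an equality; the factor [1 + 1 / (K + 1)] is the ratio of the Euler
    degrees [K + 2] and [K + 1]. *)
Lemma level_sums_log_concave (R : realFieldType) (E : finType) (w : {set E} -> R) K :
  Mnat_weight w -> (K.+1 < #|E|)%N ->
  (1 + K.+1%:R^-1) * (1 + (#|E| - K.+1)%:R^-1) * (wsum w set0 K * wsum w set0 K.+2)
    <= wsum w set0 K.+1 ^+ 2.
Proof.
move=> wP KE; pose a : R := 1 + (#|E| - K.+1)%:R^-1.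
have m0 : 0 < (#|E| - K.+1)%:R :> R by rewrite ltr0n subn_gt0.
have a0 : 0 < a by rewrite addr_gt0 ?invr_gt0.
have aE : a * (#|E| - K.+1)%:R <= (#|E| - K)%:R.
  have -> : (#|E| - K = (#|E| - K.+1).+1)%N by lia.
  by rewrite mulrDl mulVf ?gt_eqF // mul1r natr1.
have := hess_log_concave wP KE a0 aE (S := set0); rewrite cards0 => /(_ isT).
pose v (o : option E) : R := (o == None)%:R.
move=> /(_ v); rewrite !subn0.
have dotv f : dot v f = f None.
  by rewrite /dot sum_option mul1r big1 ?addr0 // => i _; rewrite mul0r.
rewrite !dotv; have -> : ap (hess w a K set0) v None = a * wsum w set0 K.
  by rewrite -[LHS](dotC v (hess w a K set0 None)) dotv.
have K0 : 0 < K.+1%:R :> R by rewrite ltr0n.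
rewrite /= -ler_pdivrMl //; apply: le_trans.
have -> : K.+2%:R = K.+1%:R + 1 :> R by rewrite natr1.
rewrite -/a; move: (K.+1%:R : R) K0 => c c0.
by rewrite le_eqVlt; apply/orP; left; apply/eqP; field; rewrite gt_eqF.
Qed.

(** * From valuations to weights *)

Lemma qweight_ge0 (R : realType) (q : R) (x : \bar R) : 0 <= qweight q x.
Proof. by case: x => [r| |] //=; exact: powR_ge0. Qed.

Lemma qweightD (R : realType) (q : R) (x y : \bar R) :
  0 < q -> x != +oo%E -> y != +oo%E ->
  qweight q (x + y)%E = qweight q x * qweight q y.
Proof.
move=> q0; case: x y => [r| |] [s| |] //= _ _; rewrite ?mulr0 ?mul0r //.
by rewrite opprD powRD // (gt_eqF q0) /= implybT.
Qed.

(** The map sending [r] to [q^(-r)] is nondecreasing for [q <= 1]. The value [+oo] is excluded for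
    [y] because [qweight] gives it the default weight 0. *)
Lemma qweight_le (R : realType) (q : R) (x y : \bar R) :
  0 < q -> q <= 1 -> y != +oo%E -> (x <= y)%E -> qweight q x <= qweight q y.
Proof.
move=> q0 q1; case: x y => [r| |] [s| |] //= _; rewrite ?powR_ge0 //.
by rewrite lee_fin => rs; apply: ger_powR; rewrite ?q0 ?lerN2.
Qed.

Lemma Mnat_weight_qweight (R : realType) (E : finType) (nu : {set E} -> \bar R) (q : R) :
  Mnat_concave nu -> 0 < q -> q <= 1 -> Mnat_weight (fun I => qweight q (nu I)).
Proof.
move=> [nuR _ nuP] q0 q1; split=> [I|I1 I2 i1 i1I]; first exact: qweight_ge0.
have mono I J I' J' : (nu I + nu J <= nu I' + nu J')%E ->
    qweight q (nu I) * qweight q (nu J) <= qweight q (nu I') * qweight q (nu J').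
  move=> le; rewrite -!qweightD ?nuR //; apply: qweight_le => //.
  by case: (nu I') (nu J') (nuR I') (nuR J') => [r| |] [s| |].
case: (nuP I1 I2 i1 i1I) => [/mono le|[i2 i2I /mono le]]; [by left|right].
by exists i2.
Qed.

Theorem theorem1p4 (R : realType) (E : finType) (nu : {set E} -> \bar R) :
  Mnat_concave nu ->
  forall (k : nat) (q : R), (0 < k)%N -> (k < #|E|)%N -> 0 < q -> q <= 1 ->
    (1 + k%:R^-1) * (1 + ((#|E| - k)%N)%:R^-1) * (Iqnu q nu k.-1 * Iqnu q nu k.+1)
      <= Iqnu q nu k ^+ 2.
Proof.
move=> nuP [//|K] q _ KE q0 q1.
have wsumE c : wsum (fun I => qweight q (nu I)) set0 c = Iqnu q nu c.
  by apply: eq_bigl => I; rewrite sub0set.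
by rewrite -!wsumE; apply: level_sums_log_concave => //; exact: Mnat_weight_qweight.
Qed.
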